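(* Let $\mathbb{R}_+=(0,+\infty)$ and let $f:\mathbb{R}_+^2\to\mathbb{R}_+^2$ be the map $$f(x,y)=\left(\alpha x^ay^b,\;\beta x^cy^d\right),$$ where $\alpha,\beta>0$ are real, $a,b,c,d\in\mathbb{Z}$, $ad-bc=1$, and $b^2+c^2\neq 0$. Then $f$ is conjugate to one of the following maps of $\mathbb{R}_+^2$: 1. $f_k(x,y)=\left(y,\frac{y^k}{x}\right)$ with $k=a+d$, if $a+d\neq 2$; 2. $f_{2,\xi}(x,y)=\left(y,\xi\frac{y^2}{x}\right)$, if $a+d=2$, where $$\xi=\begin{cases} \dfrac{\alpha^c}{\beta^{a-1}},& \text{if } c\neq 0,\\[2mm] \beta^b, & \text{if } c=0. \end{cases}$$
   Context: Two maps $f,g:\mathbb{R}_+^2\to\mathbb{R}_+^2$ are conjugate if there exists a homeomorphism $\pi:\mathbb{R}_+^2\to\mathbb{R}_+^2$ such that $\pi\circ f=g\circ\pi$. *)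

(* Defs.v *)
From mathcomp Require Import all_boot all_order all_algebra.
From mathcomp Require Import all_classical all_reals all_analysis.
Set Implicit Arguments.
Unset Strict Implicit.
Unset Printing Implicit Defensive.
Import Order.TTheory GRing.Theory Num.Theory.
Import numFieldNormedType.Exports.
Local Open Scope classical_set_scope.
Local Open Scope ring_scope.

Definition homeomorphism (T U : topologicalType) (p : T -> U) : Prop :=
  continuous p /\
  exists2 q : U -> T, continuous q & cancel p q /\ cancel q p.

Definition conjugate (T : topologicalType) (f g : T -> T) : Prop :=
  exists2 p : T -> T, homeomorphism p & p \o f = g \o p.

Definition Rpos (R : realType) : set R := [set x : R | 0 < x].
Arguments Rpos R : clear implicits.

(* [Rpos R] is coerced to the type of its elements, which carries the topology
   induced from [R]; the quadrant then has the product topology. *)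
Definition quadrant (R : realType) : topologicalType := (Rpos R * Rpos R)%type.

Definition mkpos (R : realType) (x : R) (x_gt0 : 0 < x) : Rpos R :=
  exist _ x (mem_set x_gt0).

Lemma Rpos_gt0 (R : realType) (x : Rpos R) : 0 < val x.
Proof. exact: (set_valP x). Qed.

Lemma monomial_gt0 (R : realType) (r : R) (m n : int) (p : quadrant R) :
  0 < r -> 0 < r * val p.1 ^ m * val p.2 ^ n.
Proof. by move=> r0; rewrite !mulr_gt0 ?exprz_gt0 ?Rpos_gt0. Qed.

Definition monomial_map (R : realType) (alpha beta : R)
    (alpha_gt0 : 0 < alpha) (beta_gt0 : 0 < beta) (a b c d : int)
    (p : quadrant R) : quadrant R :=
  (mkpos (monomial_gt0 a b p alpha_gt0), mkpos (monomial_gt0 c d p beta_gt0)).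

Lemma normal_form_gt0 (R : realType) (k : int) (p : quadrant R) :
  0 < val p.2 ^ k / val p.1.
Proof. by rewrite divr_gt0 ?exprz_gt0 ?Rpos_gt0. Qed.

Definition normal_form (R : realType) (k : int) (p : quadrant R) : quadrant R :=
  (p.2, mkpos (normal_form_gt0 k p)).

Lemma normal_form2_gt0 (R : realType) (xi : R) (p : quadrant R) :
  0 < xi -> 0 < xi * (val p.2 ^+ 2 / val p.1).
Proof. by move=> xi0; rewrite mulr_gt0 // divr_gt0 ?exprn_gt0 ?Rpos_gt0. Qed.

Definition normal_form2 (R : realType) (xi : R) (xi_gt0 : 0 < xi)
    (p : quadrant R) : quadrant R :=
  (p.2, mkpos (normal_form2_gt0 p xi_gt0)).

Definition xi_coef (R : realType) (alpha beta : R) (a b c : int) : R :=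
  if c != 0 then alpha ^ c / beta ^ (a - 1) else beta ^ b.

Lemma xi_coef_gt0 (R : realType) (alpha beta : R) (a b c : int) :
  0 < alpha -> 0 < beta -> 0 < xi_coef alpha beta a b c.
Proof.
by move=> a0 b0; rewrite /xi_coef; case: ifP => _; rewrite ?divr_gt0 ?exprz_gt0.
Qed.

(* Main.v *)
Require Import Defs.
From mathcomp Require Import all_boot all_order all_algebra.
From mathcomp Require Import all_classical all_reals all_analysis.
From mathcomp Require Import ring.
Import Order.TTheory GRing.Theory Num.Theory.
Import numFieldNormedType.Exports.
Local Open Scope ring_scope.

(* In logarithmic coordinates the map is affine, u |-> M u + v with det M = 1
   and tr M = k.  For a linear form l, put X = l(u) + s and Y = l(M u + v) + s;
   by Cayley-Hamilton M^2 = k M - 1, so the map becomes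
   (X, Y) |-> (Y, k Y - X + e), where e = l(M v + (1 - k) v) + (2 - k) s.
   The change of variables is invertible as soon as l is not an eigenform of M,
   which holds for the second coordinate form if c != 0 and for the first one
   if b != 0.  If k != 2 a choice of s gives e = 0; if k = 2 then e does not
   depend on s and equals ln xi. *)

(** An affine map of the plane transported to the quadrant by the exponential. The coefficients are
    real, so that one family contains the monomial map, both normal forms and the changes of
    variables. *)
Definition log_affine {R : realType} (p q r s u v : R) (z : quadrant R) :
    quadrant R :=
  let X := ln (val z.1) in let Y := ln (val z.2) in
  (mkpos (expR_gt0 (p * X + q * Y + u)), mkpos (expR_gt0 (r * X + s * Y + v))).

Lemma mkpos_eq {R : realType} (x y : R) (x0 : 0 < x) (y0 : 0 < y) :
  x = y -> mkpos x0 = mkpos y0.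
Proof. by move=> xy; apply: val_inj. Qed.

Lemma eq_log_affine {R : realType} (p q r s u v p' q' r' s' u' v' : R) :
  p = p' -> q = q' -> r = r' -> s = s' -> u = u' -> v = v' ->
  log_affine p q r s u v = log_affine p' q' r' s' u' v'.
Proof. by move=> -> -> -> -> -> ->. Qed.

(** Since [ln] undoes [expR], affine maps compose as usual; conjugacy and invertibility thereby
    become polynomial identities between coefficients. *)
Lemma log_affine_comp {R : realType}
    (p q r s u v p' q' r' s' u' v' : R) :
  log_affine p q r s u v \o log_affine p' q' r' s' u' v' =
  log_affine (p * p' + q * r') (p * q' + q * s')
             (r * p' + s * r') (r * q' + s * s')
             (p * u' + q * v' + u) (r * u' + s * v' + v).
Proof.
by apply/funext => z; congr pair; apply: mkpos_eq; rewrite /= !expRK;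
  congr expR; ring.
Qed.

Lemma log_affine_id {R : realType} : log_affine (1 : R) 0 0 1 0 0 = id.
Proof.
apply/funext => -[x y]; congr pair; apply: val_inj => /=;
  by rewrite mul1r mul0r ?addr0 ?add0r lnK // posrE Rpos_gt0.
Qed.

Lemma comp_id_cancelP {T U : Type} (f : T -> U) (g : U -> T) :
  g \o f = id <-> cancel f g.
Proof.
by split=> [gf x|fK]; [exact: (congr1 (@^~ x) gf)|apply/funext => x; exact: fK].
Qed.

(** The topology of [Rpos R] is initial for [val], so continuity can be tested after composing with
    [val]. *)
Lemma continuous_mkpos {R : realType} (T : topologicalType) (f : T -> R)
    (f0 : forall t, 0 < f t) :
  continuous f -> continuous (fun t => mkpos (f0 t)).
Proof.
by move=> cf; exact: (@continuous_comp_initial _ _ _ set_val).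
Qed.

Lemma continuous_ln_val {R : realType} :
  continuous (fun x : Rpos R => ln (val x)).
Proof.
move=> x; apply: (@continuous_comp (Rpos R) R R (fun y => val y)).
  exact: (@initial_continuous (Rpos R) R set_val).
by apply: continuous_ln; exact: Rpos_gt0.
Qed.

Lemma continuous_log_affine {R : realType} (p q r s u v : R) :
  continuous (log_affine p q r s u v).
Proof.
have cX : continuous (fun z : quadrant R => ln (val z.1) : R).
  move=> z; apply: (@continuous_comp (quadrant R) (Rpos R) R fst
    (fun x => ln (val x))); last exact: continuous_ln_val.
  exact: (@cvg_fst _ _ (nbhs z.1) (nbhs z.2)).
have cY : continuous (fun z : quadrant R => ln (val z.2) : R).
  move=> z; apply: (@continuous_comp (quadrant R) (Rpos R) R snd
    (fun x => ln (val x))); last exact: continuous_ln_val.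
  exact: (@cvg_snd _ _ (nbhs z.1) (nbhs z.2)).
have cE (m n w : R) : continuous (fun z : quadrant R =>
    expR (m * ln (val z.1) + n * ln (val z.2) + w)).
  move=> z; apply: continuous_comp; last exact: continuous_expR.
  apply: cvgD; last exact: cvg_cst.
  apply: cvgD; (apply: cvgM; first exact: cvg_cst).
    exact: cX.
  exact: cY.
have cP (m n w : R) := @continuous_mkpos R _ _ (fun z => expR_gt0 _) (cE m n w).
by move=> z; exact: (cvg_pair (cP p q u z) (cP r s v z)).
Qed.

Lemma homeomorphism_log_affine {R : realType} (p q r s u v : R) :
  p * s - q * r != 0 -> homeomorphism (log_affine p q r s u v).
Proof.
move=> D0; split; first exact: continuous_log_affine.
(* Cramer's rule: the inverse matrix is the adjugate over the determinant, and the translation is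
   minus its value at [(u, v)]. *)
exists (log_affine (s / (p * s - q * r)) (- q / (p * s - q * r))
    (- r / (p * s - q * r)) (p / (p * s - q * r))
    ((q * v - s * u) / (p * s - q * r)) ((r * u - p * v) / (p * s - q * r))).
  exact: continuous_log_affine.
by split; apply/comp_id_cancelP; rewrite log_affine_comp -[RHS]log_affine_id;
  apply: eq_log_affine; field.
Qed.

(** Here [(p, q)] is the row of the linear form l and [(A, B)] the translation; the nonvanishing
    determinant says that l and its composite with M are independent. *)
Lemma conjugate_companion {R : realType} (a b c d A B p q s k e : R) :
  a * d - b * c = 1 -> k = a + d ->
  p * (p * b + q * d) - q * (p * a + q * c) != 0 ->
  e = p * (a * A + b * B) + q * (c * A + d * B) + (1 - k) * (p * A + q * B)
      + (2 - k) * s ->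
  conjugate (log_affine a b c d A B) (log_affine 0 1 (-1) k 0 e).
Proof.
move=> det1 -> D0 ->.
have ad : a * d = 1 + b * c by rewrite -det1 subrK.
exists (log_affine p q (p * a + q * c) (p * b + q * d) s (p * A + q * B + s)).
  exact: homeomorphism_log_affine.
(* The second rows agree modulo [ad], which is how Cayley-Hamilton with determinant 1 enters. *)
rewrite !log_affine_comp; apply: eq_log_affine; by ring: ad.
Qed.

Lemma exprz_expR {R : realType} (x : R) (n : int) :
  0 < x -> x ^ n = expR (n%:~R * ln x).
Proof. by move=> x0; rewrite -powR_intmul ?ltW // /powR gt_eqF. Qed.

Lemma ln_exprz {R : realType} (x : R) (n : int) :
  0 < x -> ln (x ^ n) = n%:~R * ln x.
Proof. by move=> x0; rewrite exprz_expR // expRK. Qed.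

Lemma monomial_mapE {R : realType} (alpha beta : R)
    (alpha_gt0 : 0 < alpha) (beta_gt0 : 0 < beta) (a b c d : int) :
  monomial_map alpha_gt0 beta_gt0 a b c d =
  log_affine a%:~R b%:~R c%:~R d%:~R (ln alpha) (ln beta).
Proof.
apply/funext => z; congr pair; apply: mkpos_eq;
  rewrite !exprz_expR ?Rpos_gt0 // [RHS]expRD lnK ?posrE // expRD; ring.
Qed.

Lemma normal_formE {R : realType} (k : int) :
  @normal_form R k = log_affine 0 1 (-1) k%:~R 0 0.
Proof.
apply/funext => -[x y]; congr pair; apply: val_inj => /=.
  by rewrite mul0r mul1r add0r addr0 lnK // posrE Rpos_gt0.
rewrite addr0 mulN1r expRD expRN lnK ?posrE ?Rpos_gt0 //.
by rewrite -exprz_expR ?Rpos_gt0 // mulrC.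
Qed.

Lemma normal_form2E {R : realType} (xi : R) (xi_gt0 : 0 < xi) :
  normal_form2 xi_gt0 = log_affine 0 1 (-1) 2 0 (ln xi).
Proof.
apply/funext => -[x y]; congr pair; apply: val_inj => /=.
  by rewrite mul0r mul1r add0r addr0 lnK // posrE Rpos_gt0.
rewrite expRD lnK ?posrE // mulN1r expRD expRN lnK ?posrE ?Rpos_gt0 //.
by rewrite -(exprz_expR _ 2) ?Rpos_gt0 // mulrC [_^-1 * _]mulrC.
Qed.

Theorem theorem1 (R : realType) (alpha beta : R)
    (alpha_gt0 : 0 < alpha) (beta_gt0 : 0 < beta)
    (a b c d : int)
    (det1 : a * d - b * c = 1) (bc_neq0 : b ^+ 2 + c ^+ 2 <> 0) :
  (a + d <> 2 ->
    conjugate (monomial_map alpha_gt0 beta_gt0 a b c d)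
              (@normal_form R (a + d))) /\
  (a + d = 2 ->
    conjugate (monomial_map alpha_gt0 beta_gt0 a b c d)
              (normal_form2 (xi_coef_gt0 a b c alpha_gt0 beta_gt0))).
Proof.
rewrite monomial_mapE normal_formE normal_form2E.
have detR : a%:~R * d%:~R - b%:~R * c%:~R = 1 :> R.
  by rewrite -!intrM -intrB det1.
have b0 : c = 0 -> b != 0.
  by move=> c0; apply/eqP => b0; apply: bc_neq0; rewrite b0 c0.
split=> [k2|k2].
- have k2R : 2 - (a + d)%:~R != 0 :> R.
    by rewrite -(intrB _ 2) intr_eq0 subr_eq0 eq_sym; apply/eqP.
  have [p [q pq]] : exists p q : R,
      p * (p * b%:~R + q * d%:~R) - q * (p * a%:~R + q * c%:~R) != 0.
    (* The determinant is [b] for the first coordinate form and [- c] for the second. *)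
    have [c0|c0] := eqVneq c 0; [exists 1, 0|exists 0, 1].
      by rewrite !mul1r !mul0r subr0 addr0 intr_eq0 b0.
    by rewrite !mul1r !mul0r !add0r oppr_eq0 intr_eq0.
  set w := p * (a%:~R * ln alpha + b%:~R * ln beta)
    + q * (c%:~R * ln alpha + d%:~R * ln beta)
    + (1 - (a + d)%:~R) * (p * ln alpha + q * ln beta).
  (* [w] is the part of e free of s, so this shift solves e = 0. *)
  apply: (@conjugate_companion _ _ _ _ _ _ _ p q (- w / (2 - (a + d)%:~R)))
    => //; first by rewrite intrD.
  by rewrite -/w mulrC divfK // subrr.
- have kR : 2 = a%:~R + d%:~R :> R by rewrite -intrD k2.
  have [c0|c0] := eqVneq c 0.
    (* With c = 0, both eigenvalues [a] and [d] have product 1 and sum 2, which forces a double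
       root. *)
    have a1 : a = 1.
      have : (a - 1) ^+ 2 = 0.
        have -> : (a - 1) ^+ 2 = a * (a + d - 2) - (a * d - b * c - 1) - b * c
          by ring.
        by rewrite k2 det1 c0 !subrr !mulr0 !subr0.
      by move/eqP; rewrite expf_eq0 /= subr_eq0 => /eqP.
    (* With [a = 1] the terms in [ln alpha] cancel and e is [b] times [ln beta]. *)
    apply: (@conjugate_companion _ _ _ _ _ _ _ 1 0 0) => //.
      by rewrite !mul1r !mul0r subr0 addr0 intr_eq0 b0.
    by rewrite /xi_coef c0 eqxx ln_exprz // a1; ring.
  apply: (@conjugate_companion _ _ _ _ _ _ _ 0 1 0) => //.
    by rewrite !mul1r !mul0r !add0r oppr_eq0 intr_eq0.
  rewrite /xi_coef c0 ln_div ?posrE ?exprz_gt0 // !ln_exprz // intrB.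
  (* The coefficient of [ln beta] in e is d - 1, which the trace turns into -(a - 1), the exponent
     in [xi_coef]. *)
  have -> : d%:~R = 2 - a%:~R :> R by rewrite kR addrC addKr.
  by ring.
Qed.
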